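(* Let $Q$ be a nonempty subset of $\mathcal{M}(H^\infty(\mathbb{D}))\setminus\partial_SH^\infty(\mathbb{D})$. Then $Q$ is not a $p$-set of $H^\infty(\mathbb{D})$.
   Context: $H^\infty(\mathbb{D})$ is the Banach algebra of bounded analytic functions on the open unit disc $\mathbb{D}$ with the supremum norm. $\mathcal{M}(H^\infty(\mathbb{D}))$ is its maximal ideal space (nonzero complex homomorphisms with the weak-$*$ topology). Via the isometric Gelfand map $f\mapsto\hat f$, $\hat f(\varphi)=\varphi(f)$, $H^\infty(\mathbb{D})$ is regarded as a uniform algebra on $K=\mathcal{M}(H^\infty(\mathbb{D}))$. $\partial_SH^\infty(\mathbb{D})$ is the Šilov boundary: the smallest closed subset of $\mathcal{M}(H^\infty(\mathbb{D}))$ on which every $\hat f$ attains its maximum modulus. For a uniform algebra $A$ on a compact Hausdorff space $K$, a closed set $C\subseteq K$ is a peak set if there is $f\in A$ with $f|_C\equiv1$ and $|f(x)|<1$ for all $x\in K\setminus C$; a set $P\subseteq K$ is a $p$-set of $A$ if it is the intersection of a family of peak sets. *)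

(* Defs.v *)
From HB Require Import structures.
From mathcomp Require Import all_boot all_order all_algebra.
From mathcomp Require Import all_classical all_reals all_analysis.
From mathcomp Require Export complex.

Set Implicit Arguments.
Unset Strict Implicit.
Unset Printing Implicit Defensive.

Import Order.TTheory GRing.Theory Num.Theory.
Import numFieldNormedType.Exports.

Local Open Scope classical_set_scope.
Local Open Scope ring_scope.

(* Everything about H^oo is stated over an abstract [C : numFieldType], so that
   the norm topology and the derivative of MathComp-Analysis apply directly; the
   complex plane is the instance [C := R[i]] with [R : realType], for which
   [derivable f z 1] is complex differentiability. *)

Section Hinf.
Variable C : numFieldType.

Definition disc : set C := [set z | `|z| < 1].

(* ['valL_0 f] extends [f : disc -> C] by 0; as [disc] is open, differentiability
   at a point of [disc] does not depend on the extension. *)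
Definition analytic_on_disc (f : disc -> C) : Prop :=
  forall z : disc, derivable ('valL_0 f) (val z) 1.

Definition bounded_on_disc (f : disc -> C) : Prop :=
  exists M : C, forall z : disc, `|f z| <= M.

Definition bounded_analytic : {pred disc -> C} :=
  fun f => `[< analytic_on_disc f /\ bounded_on_disc f >].

Lemma valL_near (f : disc -> C) (F : C -> C) (z : disc) :
  (forall w : disc, F (val w) = f w) -> \forall x \near val z, F x = 'valL_0 f x.
Proof.
move=> Ff; have zD : `|val z| < 1 by have /set_mem := valP z.
near=> x.
have xD : disc x.
  rewrite /disc/=; near: x.
  exact: (cvgr_norm_lt (val z) (@cvg_id _ (nbhs (val z)))).
have -> : x = val (SigSub (mem_set xD) : disc) by [].
rewrite Ff; have := valLK 0 f => /(congr1 (fun g => g (SigSub (mem_set xD)))).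
by rewrite /sigL/=.
Unshelve. all: by end_near. Qed.

Lemma analytic_ext (f : disc -> C) (F : C -> C) :
  (forall w : disc, F (val w) = f w) ->
  (forall z : disc, derivable F (val z) 1) -> analytic_on_disc f.
Proof. by move=> Ff dF z; exact: near_eq_derivable (valL_near z Ff) (dF z). Qed.

Lemma valL_val (f : disc -> C) (w : disc) : 'valL_0 f (val w) = f w.
Proof. by have := congr1 (fun g => g w) (valLK 0 f). Qed.

Lemma bounded_analytic_subring : GRing.subring_closed bounded_analytic.
Proof.
split=> [|f g /asboolP[df [M fM]] /asboolP[dg [N gN]]
         |f g /asboolP[df [M fM]] /asboolP[dg [N gN]]]; apply/asboolP; split.
- by apply: (@analytic_ext _ (cst 1)) => // z; exact: derivable_cst.
- by exists 1 => z; rewrite normr1.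
- apply: (@analytic_ext _ ('valL_0 f - 'valL_0 g)) => [w|z].
    exact: (congr2 (fun a b => a - b) (valL_val f w) (valL_val g w)).
  exact: derivableB.
- exists (M + N) => z; apply: le_trans (ler_normB _ _) _.
  by rewrite lerD.
- apply: (@analytic_ext _ ('valL_0 f * 'valL_0 g)) => [w|z].
    exact: (congr2 (fun a b => a * b) (valL_val f w) (valL_val g w)).
  exact: derivableM.
- by exists (M * N) => z; rewrite normrM ler_pM.
Qed.

Lemma bounded_analytic_scaler : GRing.scaler_closed bounded_analytic.
Proof.
move=> a f /asboolP[df [M fM]]; apply/asboolP; split.
- apply: (@analytic_ext _ (a *: 'valL_0 f)) => [w|z].
    exact: (congr1 (fun b => a * b) (valL_val f w)).
  exact: derivableZ.
- by exists (`|a| * M) => z; rewrite normrM ler_wpM2l.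
Qed.

HB.instance Definition _ :=
  GRing.isSubringClosed.Build (disc -> C) bounded_analytic
    bounded_analytic_subring.
HB.instance Definition _ :=
  GRing.isScaleClosed.Build C (disc -> C) bounded_analytic
    bounded_analytic_scaler.

Record Hinf := MkHinf {
  Hinf_fun :> disc -> C;
  Hinf_funP : Hinf_fun \in bounded_analytic }.

HB.instance Definition _ := [isSub for Hinf_fun].
HB.instance Definition _ := [Choice of Hinf by <:].
HB.instance Definition _ := 
  GRing.SubChoice_isSubComPzRing.Build _ _ Hinf (subringClosedP _).
HB.instance Definition _ := [SubZmodule_isSubLmodule of Hinf by <:].

(* [scalar] is C-linearity; continuity is automatic and not assumed. *)
Definition complex_homomorphisms : set {ptws Hinf -> C} :=
  [set phi : Hinf -> C |
    [/\ scalar phi, {morph phi : f g / f * g} & exists f, phi f != 0]].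

(* Subspace of the product [{ptws Hinf -> C}]: the weak-* topology. *)
Definition maximal_ideal_space : topologicalType := complex_homomorphisms.

Definition gelfand (f : Hinf) (phi : maximal_ideal_space) : C :=
  (set_val phi : {ptws Hinf -> C}) f.

Definition Hinf_hat : set (maximal_ideal_space -> C) := range gelfand.

End Hinf.

Arguments disc : clear implicits.
Arguments Hinf : clear implicits.
Arguments complex_homomorphisms : clear implicits.
Arguments maximal_ideal_space : clear implicits.
Arguments Hinf_hat : clear implicits.

Section FunctionAlgebra.
Variables (C : numFieldType) (K : topologicalType) (A : set (K -> C)).

Definition closed_boundary (S : set K) : Prop :=
  closed S /\
  forall f, A f -> exists2 x, S x & forall y, `|f y| <= `|f x|.

(* [smallest P set0] is the intersection of all sets satisfying [P]; it is the
   least such set whenever a least one exists, which for Hinf_hat is Shilov's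
   theorem. *)
Definition shilov_boundary : set K := smallest closed_boundary set0.

Definition peak_set (P : set K) : Prop :=
  closed P /\
  exists2 f, A f & (forall x, P x -> f x = 1) /\ (forall x, ~ P x -> `|f x| < 1).

Definition p_set (P : set K) : Prop :=
  exists2 F : set (set K), F `<=` peak_set & P = \bigcap_(S in F) S.

End FunctionAlgebra.

(* Main.v *)
Require Import Defs.
From mathcomp Require Import all_boot all_order all_algebra.
From mathcomp Require Import all_classical all_reals all_analysis.

Set Implicit Arguments.
Unset Strict Implicit.
Unset Printing Implicit Defensive.

Import Order.TTheory GRing.Theory Num.Theory.
Import numFieldNormedType.Exports.

Local Open Scope classical_set_scope.
Local Open Scope ring_scope.
Local Open Scope complex_scope.

(** Every nonempty p-set of a point-separating algebra A of continuous
    functions on a compact space K meets the Shilov boundary; the theorem is the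
    case A = H^oo, K its maximal ideal space.

    A nonempty peak set P, with peaking function f, meets every closed boundary
    S: the modulus of f is maximal exactly on P, and this maximum is attained on
    S.
    Peak sets are stable under finite intersection (multiply the peaking
    functions), so by compactness of S an intersection of peak sets having a
    common point meets S as well ([p_set_meets_boundary]).

    It remains to apply this to S the Shilov boundary, so the intersection of all
    closed boundaries must itself be a closed boundary (Shilov's theorem,
    [shilov_boundaryP]). Compactness and Zorn's lemma give a minimal closed
    boundary S0. Suppose that x in S0 lies outside another closed boundary S. A
    neighbourhood of x disjoint from S contains one of the form
    V = {y | |f y| < 1 for all f in s}, with s a finite list in A. By minimality
    S0 \ V is not a boundary, so some h in A has maximum modulus 1 on K and
    |h| < 1 on S0 \ V. For n large |h ^ n f| < 1 on S0, hence on K, for all f in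
    s; then any point where |h| = 1 lies in V, although h attains its maximum on
    S, which is disjoint from V ([minimal_boundary_least]).

    For H^oo, a character phi satisfies |phi f| <= sup |f|, because phi f - f is
    invertible when |phi f| > sup |f| ([character_bound]). The characters
    therefore form a closed subset of a product of closed discs, compact by
    Tychonoff's theorem ([compact_characters]). *)

(** * Compactness and the maximum modulus *)

(** The form in which compactness is used throughout: [B] need only be directed
    downwards, so chains, finite intersections of peak sets and superlevel sets of
    a modulus are all covered. *)
Lemma directed_closed_meet (T : topologicalType) (I : Type) (D : set I)
    (B : I -> set T) (S : set T) :
  compact S -> D !=set0 -> (forall i, D i -> closed (B i)) ->
  (forall i j, D i -> D j -> exists2 k, D k & B k `<=` B i `&` B j) ->
  (forall i, D i -> S `&` B i !=set0) ->
  exists2 x, S x & forall i, D i -> B i x.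
Proof.
move=> cS D0 clB dirB SB0; pose F := filter_from D (fun i => S `&` B i).
have FF : ProperFilter F.
  apply: filter_from_proper => //; apply: filter_from_filter => // i j Di Dj.
  have [k Dk kij] := dirB i j Di Dj; exists k => //.
  by move=> x [Sx /kij[]].
have [|x [Sx clx]] := cS F FF.
  by have [i Di] := D0; exists i => // y [].
exists x => // i Di; apply: (clB i Di) => U Ux.
have [|y [[_ By] Uy]] := clx (S `&` B i) U _ Ux; first by exists i.
by exists y.
Qed.

Lemma bernoulli_le (C : numDomainType) (d : C) n :
  0 <= d -> 1 + d *+ n <= (1 + d) ^+ n.
Proof.
move=> d0; elim: n => [|n IH]; first by rewrite mulr0n addr0 expr0.
rewrite exprS; apply: le_trans (ler_wpM2l _ IH); last by rewrite addr_ge0.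
rewrite mulrDl mul1r mulrDr mulr1 mulrSr !addrA lerDl.
by rewrite mulr_ge0// mulrn_wge0.
Qed.

Section Modulus.
Variables (C : numFieldType) (K : topologicalType).
Implicit Types (f g : K -> C) (S : set K) (x y : K).

Lemma norm_ltNge (a b : C) : (`|a| < `|b|) = ~~ (`|b| <= `|a|).
Proof. by rewrite real_ltNge// normr_real. Qed.

Lemma continuous_add f g :
  continuous f -> continuous g -> continuous (fun x => f x + g x).
Proof. by move=> cf cg x; apply: cvgD; [exact: cf|exact: cg]. Qed.

Lemma continuous_mul f g :
  continuous f -> continuous g -> continuous (fun x => f x * g x).
Proof. by move=> cf cg x; apply: cvgM; [exact: cf|exact: cg]. Qed.

Lemma closed_eq_continuous f g :
  continuous f -> continuous g -> closed [set x | f x = g x].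
Proof.
move=> cf cg.
have -> : [set x | f x = g x] = (f - g) @^-1` [set 0].
  apply/seteqP; split=> x /=; first by move=> fg; rewrite fctE fg subrr.
  by move/eqP; rewrite fctE subr_eq0 => /eqP.
apply: preimage_closed; last first.
  exact: accessible_closed_set1 (hausdorff_accessible (@norm_hausdorff C C^o)) 0.
by move=> x _; apply: cvgB; [exact: cf|exact: cg].
Qed.

Lemma closed_norm_ge f (M : C) : M \is Num.real -> continuous f ->
  closed [set y | M <= `|f y|].
Proof.
move=> Mr cf; rewrite -[X in closed X]setCK; apply: open_closedC.
rewrite openE => y /= /negP; rewrite -real_ltNge ?normr_real// => yM.
apply: filterS (cvgr_norm_lt (f y) (cf y) _ yM) => z /= zM.
by apply/negP; rewrite -real_ltNge ?normr_real.
Qed.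

Lemma closed_norm_le f (M : C) : M \is Num.real -> continuous f ->
  closed [set y | `|f y| <= M].
Proof.
move=> Mr cf; rewrite -[X in closed X]setCK; apply: open_closedC.
rewrite openE => y /= /negP; rewrite -real_ltNge ?normr_real// => yM.
apply: filterS (cvgr_norm_gt (f y) (cf y) _ yM) => z /= zM.
by apply/negP; rewrite -real_ltNge ?normr_real.
Qed.

Lemma open_norm_lt f (M : C) : continuous f -> open [set y | `|f y| < M].
Proof.
move=> cf; rewrite openE => y /= yM.
exact: filterS (cvgr_norm_lt (f y) (cf y) _ yM).
Qed.

(** The superlevel sets of a modulus form a chain of closed sets, so compactness
    of [S] alone yields a maximum, whichever numeric field the values lie in. *)
Lemma max_modulus f S : compact S -> S !=set0 -> continuous f ->
  exists2 c, S c & forall y, S y -> `|f y| <= `|f c|.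
Proof.
move=> cS S0 cf.
apply: (directed_closed_meet (B := fun x => [set y | `|f x| <= `|f y|]) cS S0).
- by move=> x _; exact: closed_norm_ge.
- move=> x y Sx Sy; have [xy|yx] := boolP (`|f x| <= `|f y|).
    by exists y => // z /= yz; split=> //; apply: le_trans yz.
  exists x => // z /= xz; split=> //; apply: le_trans xz.
  by apply: ltW; rewrite norm_ltNge.
- by move=> x Sx; exists x; split => /=.
Qed.

End Modulus.

(** * The Shilov boundary of a separating algebra *)

Section Shilov.
Variables (C : numFieldType) (K : topologicalType) (A : set (K -> C)).

Record separating_algebra : Prop := SeparatingAlgebra {
  sa_continuous : forall f, A f -> continuous f;
  sa_cst : forall c, A (fun=> c);
  sa_add : forall f g, A f -> A g -> A (fun x => f x + g x);
  sa_mul : forall f g, A f -> A g -> A (fun x => f x * g x);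
  sa_separates : forall x y, x <> y -> exists2 f, A f & f x != f y }.

Hypothesis sA : separating_algebra.
Hypothesis cK : compact [set: K].
Hypothesis archi : forall x : C, exists n : nat, `|x| < n%:R.

Lemma sa_exp f n : A f -> A (fun x => f x ^+ n).
Proof.
move=> Af; elim: n => [|n IH].
  by under eq_fun do rewrite expr0; exact: (sa_cst sA).
by under eq_fun do rewrite exprS; exact: (sa_mul sA).
Qed.

Lemma exists_expr_lt (r M : C) : 0 <= r < 1 -> 0 <= M ->
  exists n, r ^+ n * M < 1.
Proof.
move=> /andP[r0 r1] M0; have [->|rN0] := eqVneq r 0.
  by exists 1%N; rewrite expr1 mul0r.
have r_gt0 : 0 < r by rewrite lt_def rN0.
pose d := r^-1 - 1.
have d0 : 0 < d by rewrite subr_gt0 invf_gt1.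
have [n] := archi (M / d); rewrite ger0_norm ?divr_ge0 ?(ltW d0)//.
rewrite ltr_pdivrMr// => Mn; exists n.
have : M < r^-1 ^+ n.
  have -> : r^-1 = 1 + d by rewrite /d addrC subrK.
  apply: lt_le_trans (bernoulli_le _ (ltW d0)).
  by apply: lt_le_trans Mn _; rewrite mulr_natl lerDr.
by rewrite exprVn -[_^-1]mulr1 -ltr_pdivrMl ?invr_gt0 ?exprn_gt0// invrK.
Qed.

(** For f in A, the points where |f| is maximal form a closed set meeting each
    member of the chain; compactness gives one common to all members. *)
Lemma chain_bigcap_boundary (F : set (set K)) :
  F `<=` closed_boundary A -> total_on F subset -> [set: K] !=set0 ->
  closed_boundary A (\bigcap_(S in F) S).
Proof.
move=> Fb Ft K0; split; first by apply: closed_bigI => S /Fb[].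
move=> f Af.
have cf := sa_continuous sA Af.
have [c _ cmax] := max_modulus cK K0 cf.
have [F0|/set0P/negP/negPn/eqP F0] := pselect (F !=set0); last first.
  by exists c => [S|y]; [rewrite F0|exact: cmax].
pose B (S : set K) := S `&` [set y | `|f c| <= `|f y|].
have [||||x _ xB] := directed_closed_meet (D := F) (B := B) cK.
- exact: F0.
- move=> S /Fb[clS _]; apply: closedI => //; exact: closed_norm_ge.
- move=> S S' FS FS'; have [SS'|SS'] := Ft _ _ FS FS'.
    by exists S => // y [Sy fy]; split; split => //; exact: SS'.
  by exists S' => // y [Sy fy]; split; split => //; exact: SS'.
- move=> S /Fb[_ /(_ f Af)[x Sx xmax]].
  by exists x; split=> //; split=> //=; exact: xmax.
exists x => [S /xB[]//|y].
have [S FS] := F0; have [_ /= cx] := xB S FS.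
exact: le_trans (cmax y Logic.I) cx.
Qed.

(** Zorn's lemma, applied to the complements of closed boundaries. *)
Lemma exists_minimal_boundary : [set: K] !=set0 ->
  exists2 S, closed_boundary A S &
    forall S', closed_boundary A S' -> S' `<=` S -> S' = S.
Proof.
move=> K0; have [F FP Ft|U [PU Umax]] :=
  @Zorn_bigcup K (fun U => closed_boundary A (~` U)).
  rewrite setC_bigcup -(bigcap_image F setC id).
  apply: chain_bigcap_boundary => //.
    by move=> _ [U FU <-]; exact: FP.
  move=> _ _ [U FU <-] [V FV <-]; have [UV|VU] := Ft _ _ FU FV.
    by right; exact: subsetC.
  by left; exact: subsetC.
exists (~` U) => // S' bS' S'U; apply/seteqP; split=> // x Ux.
apply: contrapT => S'x; apply: (Umax (~` S')); last by rewrite setCK.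
split; first by move=> y Uy /S'U.
by move/(_ x S'x).
Qed.

(** A compact topology is generated by any point-separating algebra of continuous
    functions: if every polyhedron around [x] left [U], compactness would give a
    point outside [U] that no function of [A] separates from [x]. *)
Lemma nbhs_unit_polyhedron (x : K) (U : set K) : nbhs x U ->
  exists s : seq (K -> C),
    (forall f, f \in s -> A f /\ f x = 0) /\
    (forall y, (forall f, f \in s -> `|f y| < 1) -> U y).
Proof.
move=> Ux; apply: contrapT => noS.
pose D := [set s : seq (K -> C) | forall f, f \in s -> A f /\ f x = 0].
pose B (s : seq (K -> C)) :=
  ~` U° `&` [set y | forall f, f \in s -> `|f y| <= 1].
have [||||y _ yB] := directed_closed_meet (D := D) (B := B) cK.
- by exists [::].
- move=> s Ds; apply: closedI; first exact: open_closedC (open_interior U).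
  have -> : [set y | forall f, f \in s -> `|f y| <= 1] =
      \bigcap_(f in [set` s]) [set y | `|f y| <= 1] by [].
  apply: closed_bigI => f /= /Ds[/(sa_continuous sA) cf _].
  by apply: closed_norm_le.
- move=> s t Ds Dt; exists (s ++ t).
    by move=> f; rewrite mem_cat => /orP[/Ds|/Dt].
  move=> y [Uy st]; split; split=> // f fs; apply: st; rewrite mem_cat fs ?orbT//.
- move=> s Ds; apply: contrapT => sB0; apply: noS; exists s; split=> // y sy.
  apply: interior_subset; apply: contrapT => Uy; apply: sB0; exists y; split=> //.
  by split=> // f /sy/ltW.
have [|Uy _] := yB [::]; first by [].
have xy : x <> y by move=> xy; apply: Uy; rewrite -xy.
have [f Af fxy] := sa_separates sA xy.
(* Normalized so that g x = 0 and g y = 2, against the bound |g y| <= 1. *)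
pose g z := 2 / (f y - f x) * (f z - f x).
have Ag : A g.
  apply: (sa_mul sA); first exact: (sa_cst sA).
  by apply: (sa_add sA) => //; exact: (sa_cst sA).
have [|_ /(_ g)] := yB [:: g].
  by move=> k; rewrite inE => /eqP->; split=> //; rewrite /g subrr mulr0.
rewrite inE eqxx => /(_ isT); rewrite /g divfK ?subr_eq0 1?eq_sym//.
by rewrite normr_nat (ler_nat _ 2 1).
Qed.

Lemma open_unit_polyhedron (s : seq (K -> C)) :
  (forall f, f \in s -> continuous f) ->
  open [set y | forall f, f \in s -> `|f y| < 1].
Proof.
elim: s => [|f s IH] cs.
  by rewrite (_ : mkset _ = setT); [exact: openT|apply/seteqP; split].
have -> : [set y | forall g, g \in f :: s -> `|g y| < 1] =
    [set y | `|f y| < 1] `&` [set y | forall g, g \in s -> `|g y| < 1].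
  apply/seteqP; split=> y /= ys.
    by split=> [|g gs]; apply: ys; rewrite inE ?eqxx ?gs ?orbT.
  by case: ys => fy sy g; rewrite inE => /orP[/eqP->//|]; exact: sy.
apply: openI; first by apply: open_norm_lt; apply: cs; rewrite inE eqxx.
by apply: IH => g gs; apply: cs; rewrite inE gs orbT.
Qed.

(** By compactness |h| is bounded on [T] by some r < 1, and r ^ n beats the
    maxima of the finitely many |f|. *)
Lemma exists_power_small (T : set K) (h : K -> C) (s : seq (K -> C)) :
  compact T -> continuous h -> (forall y, T y -> `|h y| < 1) ->
  (forall f, f \in s -> continuous f) ->
  exists n, forall f y, f \in s -> T y -> `|h y ^+ n * f y| < 1.
Proof.
move=> cT ch h1 cs.
have [T0|/set0P/negP/negPn/eqP->] := pselect (T !=set0); last first.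
  by exists 0%N.
have [c Tc hc] := max_modulus cT T0 ch.
elim: s cs => [|f s IH] cs; first by exists 0%N.
have [|n nP] := IH; first by move=> g gs; apply: cs; rewrite inE gs orbT.
have [|e Te fe] := max_modulus cT T0 (cs f _); first by rewrite inE eqxx.
have [||m mP] := @exists_expr_lt `|h c| `|f e|; [by rewrite normr_ge0 h1|by []|].
exists (maxn n m) => g y gs Ty.
have hy k : (k <= maxn n m)%N -> `|h y ^+ maxn n m| <= `|h y ^+ k|.
  by move=> km; rewrite !normrX ler_wiXn2l// ltW// h1.
move: gs; rewrite inE normrM => /orP[/eqP->|gs].
  apply: le_lt_trans mP; apply: ler_pM => //; last exact: fe.
  apply: le_trans (hy m (leq_maxr _ _)) _.
  by rewrite normrX lerXn2r ?nnegrE// hc.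
apply: le_lt_trans (nP g y gs Ty); rewrite normrM; apply: ler_wpM2r => //.
by rewrite hy// leq_maxl.
Qed.

(** Shilov's argument: by minimality some function has its maximal modulus on
    [S0] only near a given point, and this forces every closed boundary to come
    close to that point. *)
Lemma minimal_boundary_least S0 :
  closed_boundary A S0 ->
  (forall S', closed_boundary A S' -> S' `<=` S0 -> S' = S0) ->
  forall S, closed_boundary A S -> S0 `<=` S.
Proof.
move=> [clS0 bS0] S0min S [clS bS] x S0x; apply: contrapT => Sx.
have [|s [sP sV]] := @nbhs_unit_polyhedron x (~` S).
  by apply: open_nbhs_nbhs; split=> //; exact: closed_openC.
pose V := [set y | forall f, f \in s -> `|f y| < 1].
have Vx : V x by move=> f /sP[_ ->]; rewrite normr0.
pose T := S0 `&` ~` V.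
have clT : closed T.
  apply: closedI => //; apply: open_closedC; apply: open_unit_polyhedron.
  by move=> f /sP[/(sa_continuous sA)].
(* By minimality T is not a boundary; h is a witness of this, normalized at a
   point p where its modulus is maximal. *)
have [h Ah [p hp [h1 hT]]] : exists2 h, A h & exists2 p, h p = 1 &
    (forall y, `|h y| <= 1) /\ (forall y, T y -> `|h y| < 1).
  have [[t Tt]|T0] := pselect (T !=set0); last first.
    exists (fun=> 1); first exact: (sa_cst sA).
    exists x => //; split=> y; first by rewrite normr1.
    by move=> Ty; case: T0; exists y.
  have [g [Ag gmax]] : exists g, A g /\
      ~ exists2 y, T y & forall z, `|g z| <= `|g y|.
    apply: contrapT => noG.
    suff TS0 : T = S0 by have : T x by [rewrite TS0]; case.
    apply: S0min; last by move=> y [].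
    split=> // g Ag; apply: contrapT => gmax; apply: noG; exists g; split=> //.
  have [p S0p pmax] := bS0 g Ag.
  have gT y : T y -> `|g y| < `|g p|.
    move=> Ty; rewrite norm_ltNge; apply/negP => gpy; apply: gmax.
    by exists y => // z; exact: le_trans (pmax z) gpy.
  have gp0 : 0 < `|g p| by apply: le_lt_trans (gT t Tt).
  exists (fun y => (g p)^-1 * g y).
    by apply: (sa_mul sA) => //; exact: (sa_cst sA).
  exists p; first by rewrite mulVf// -normr_gt0.
  split=> [y|y Ty]; rewrite normrM normfV.
    by rewrite ler_pdivrMl// mulr1.
  by rewrite ltr_pdivrMl// mulr1 gT.
have cT : compact T by exact: (subclosed_compact clT cK).
have [|||n nP] := @exists_power_small T h s cT.
- exact: (sa_continuous sA).
- exact: hT.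
- by move=> f /sP[/(sa_continuous sA)].
(* On S0 the bound comes from V or from T; S0 is a boundary, so it holds on K. *)
have hf1 f y : f \in s -> `|h y ^+ n * f y| < 1.
  move=> fs; have [Af _] := sP f fs.
  have [q S0q qmax] := bS0 _ (sa_mul sA (sa_exp n Ah) Af).
  apply: le_lt_trans (qmax y) _ => /=.
  have [Vq|Vq] := pselect (V q); last by exact: nP.
  rewrite normrM; apply: le_lt_trans (Vq f fs).
  by rewrite ler_piMl// normrX exprn_ile1.
have [q Sq qmax] := bS h Ah.
have hq : `|h q| = 1.
  apply/eqP; rewrite eq_le h1/=.
  by have := qmax p; rewrite hp normr1.
apply: (sV q) Sq => f fs; have := hf1 f q fs.
by rewrite normrM normrX hq expr1n mul1r.
Qed.

Theorem shilov_boundaryP : [set: K] !=set0 ->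
  closed_boundary A (shilov_boundary A).
Proof.
move=> /exists_minimal_boundary[S0 bS0 S0min].
suff -> : shilov_boundary A = S0 by [].
apply/seteqP; split; first by move=> x /(_ S0); apply; split.
by move=> x S0x S [bS _]; exact: (minimal_boundary_least bS0 S0min bS).
Qed.

(** * Peak sets and p-sets *)

Lemma peak_set_setT : peak_set A setT.
Proof.
split; first exact: closedT.
exists (fun=> 1); first exact: (sa_cst sA).
by split=> // x [].
Qed.

Lemma peak_set_le1 P f : (forall x, P x -> f x = 1) ->
  (forall x, ~ P x -> `|f x| < 1) -> forall x : K, `|f x| <= 1 :> C.
Proof.
move=> f1 flt x; have [/f1->|/flt/ltW//] := pselect (P x); by rewrite normr1.
Qed.

Lemma peak_setI P Q : peak_set A P -> peak_set A Q -> peak_set A (P `&` Q).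
Proof.
move=> [clP [f Af [f1 flt]]] [clQ [g Ag [g1 glt]]]; split; first exact: closedI.
exists (fun x => f x * g x); first exact: (sa_mul sA).
split=> [x [/f1-> /g1->]|x]; first by rewrite mulr1.
have f_le := peak_set_le1 f1 flt x; have g_le := peak_set_le1 g1 glt x.
move=> /not_andP[/flt|/glt] lt1; rewrite normrM.
  by apply: le_lt_trans lt1; rewrite ler_piMr.
by apply: le_lt_trans lt1; rewrite ler_piMl.
Qed.

Lemma peak_set_meets_boundary P S : peak_set A P -> closed_boundary A S ->
  P !=set0 -> S `&` P !=set0.
Proof.
move=> [_ [f Af [f1 flt]]] [_ bS] [q Pq]; have [x Sx xmax] := bS f Af.
exists x; split=> //; apply: contrapT => /flt.
by move=> /(le_lt_trans (xmax q)); rewrite f1// normr1 ltxx.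
Qed.

(** The family of all peak sets through a point q of [Q] is directed, and its
    intersection is contained in [Q]. *)
Theorem p_set_meets_boundary Q S : p_set A Q -> closed_boundary A S ->
  Q !=set0 -> S `&` Q !=set0.
Proof.
move=> [F Fpeak QF] bS [q Qq].
pose D := [set P | peak_set A P /\ P q].
have cS : compact S by apply: subclosed_compact cK _ => //; case: bS.
have [||||x Sx xD] := directed_closed_meet (D := D) (B := id) cS.
- by exists setT; split=> //; exact: peak_set_setT.
- by move=> P [[]].
- move=> P P' [pP Pq] [pP' P'q]; exists (P `&` P') => //.
  by split; [exact: peak_setI|].
- by move=> P [pP Pq]; apply: peak_set_meets_boundary => //; exists q.
exists x; split=> //; rewrite QF => P FP; apply: xD; split; first exact: Fpeak.
by move: Qq; rewrite QF; apply.
Qed.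

End Shilov.

(** * The maximal ideal space of H^oo *)

Section Spectrum.
Variable C : numFieldType.

Lemma Hinf_inverse (f : Hinf C) (l d : C) : 0 < d ->
  (forall z, d <= `|l - f z|) ->
  exists g : Hinf C, ((l *: (1 : Hinf C) : Hinf C) - f) * g = 1.
Proof.
move=> d0 lf.
have nz z : l - f z != 0 by rewrite -normr_gt0 (lt_le_trans d0).
have [df _] := asboolP _ (Hinf_funP f).
have gP : (fun z => (l - f z)^-1) \in @bounded_analytic C.
  apply/asboolP; split.
    apply: (@analytic_ext _ _ (fun x => (l - 'valL_0 f x)^-1)) => [w|z].
      by rewrite valL_val.
    apply: derivableV; first by rewrite valL_val.
    by apply: derivableB; [exact: derivable_cst|exact: df].
  exists d^-1 => z; rewrite normfV lef_pV2 ?posrE// normr_gt0//.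
exists (MkHinf gP); apply: val_inj; apply/funext => z /=.
change ((l * 1 - f z) * (l - f z)^-1 = 1).
by rewrite mulr1 mulfV.
Qed.

Lemma character1 (phi : Hinf C -> C) : complex_homomorphisms C phi -> phi 1 = 1.
Proof.
move=> [_ phiM [f f0]]; apply: (mulIf f0).
by rewrite -phiM !mul1r.
Qed.

Lemma character_cst (phi : Hinf C -> C) (c : C) :
  complex_homomorphisms C phi -> phi (c *: (1 : Hinf C) : Hinf C) = c.
Proof.
move=> phiP; have [phiL _ _] := phiP.
have phi0 : phi 0 = 0.
  by have := phiL (-1) 0 0; rewrite scaler0 addr0 mulN1r addNr.
have := phiL c 1 0; rewrite addr0 => ->.
by rewrite phi0 addr0 (character1 phiP) mulr1.
Qed.

(** Characters are contractive for the supremum norm: were |phi f| larger than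
    [M], phi f - f would be invertible while phi vanishes at it. *)
Lemma character_bound (phi : Hinf C -> C) (f : Hinf C) (M : C) :
  complex_homomorphisms C phi -> (forall z, `|f z| <= M) -> `|phi f| <= M.
Proof.
move=> phiP fM; have [phiL phiM _] := phiP.
have M0 : 0 <= M.
  have z0 : disc C 0 by rewrite /disc/= normr0.
  exact: le_trans (fM (SigSub (mem_set z0))).
rewrite real_leNgt ?normr_real ?ger0_real//; apply/negP => Mphi.
have [|z|g gP] := @Hinf_inverse f (phi f) (`|phi f| - M).
    by rewrite subr_gt0.
  by apply: le_trans (lerB_dist _ _); rewrite lerB.
have := phiM ((phi f *: (1 : Hinf C) : Hinf C) - f) g.
rewrite gP (character1 phiP) addrC -scaleN1r phiL (character_cst _ phiP).
by rewrite mulN1r addNr mul0r => /eqP; rewrite oner_eq0.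
Qed.

Hypothesis compact_ball : forall M : C, compact [set z : C | `|z| <= M].

Lemma continuous_eval (f : Hinf C) :
  continuous (fun phi : {ptws Hinf C -> C} => phi f).
Proof. exact: (@proj_continuous (Hinf C) (fun=> C) f). Qed.

(** Each f being bounded by some N f, the characters lie in the product of the
    discs of radius N f, where they are cut out by closed conditions;
    nontriviality becomes the closed condition phi 1 = 1. *)
Lemma compact_characters : compact (complex_homomorphisms C).
Proof.
have /choice[N NP] : forall f : Hinf C, exists M : C, forall z, `|f z| <= M.
  by move=> f; have [_] := asboolP _ (Hinf_funP f).
apply: (@subclosed_compact _ _
  [set phi : {ptws Hinf C -> C} | forall f, `|phi f| <= N f]); last first.
- by move=> phi phiP f; exact: character_bound.
- exact: (@tychonoff (Hinf C) (fun=> C) (fun f => [set z : C | `|z| <= N f])).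
have -> : complex_homomorphisms C =
  (\bigcap_(p : C * Hinf C * Hinf C)
     [set phi : {ptws Hinf C -> C} |
       phi (p.1.1 *: p.1.2 + p.2) = p.1.1 * phi p.1.2 + phi p.2]) `&`
  (\bigcap_(p : Hinf C * Hinf C)
     [set phi : {ptws Hinf C -> C} | phi (p.1 * p.2) = phi p.1 * phi p.2]) `&`
  [set phi : {ptws Hinf C -> C} | phi 1 = 1].
  apply/seteqP; split=> phi.
    move=> phiP; have [phiL phiM _] := phiP.
    split; first split; last exact: character1.
      by move=> [[a f] g] _; exact: phiL.
    by move=> [f g] _; exact: phiM.
  move=> [[phiL phiM] phi1]; split=> [a f g|f g|].
  - exact: (phiL (a, f, g)).
  - exact: (phiM (f, g)).
  - by exists 1; rewrite phi1 oner_eq0.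
apply: closedI; first apply: closedI.
- apply: closed_bigI => -[[a f] g] _.
  exact: (closed_eq_continuous (@continuous_eval (a *: f + g))
    (continuous_add
      (continuous_mul (fun phi => cvg_cst a) (@continuous_eval f))
      (@continuous_eval g))).
- apply: closed_bigI => -[f g] _.
  exact: (closed_eq_continuous (@continuous_eval (f * g))
    (continuous_mul (@continuous_eval f) (@continuous_eval g))).
- by apply: (closed_eq_continuous (g := fun=> 1 : C) (@continuous_eval 1));
    exact: cst_continuous.
Qed.

Lemma compact_set_type (T : topologicalType) (S : set T) :
  compact S -> compact [set: S].
Proof.
move=> cS F FF _.
have [|x [Sx clx]] := cS (set_val @ F) _.
  apply: (@filterS _ F _ setT); [by move=> x _; exact: set_valP|exact: filterT].
exists (SigSub (mem_set Sx)); split=> // P U FP [V [[W oW <-] Vx VU]].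
have FP' : (set_val @ F) (set_val @` P).
  by apply: (@filterS _ F _ P) FP => y Py; exists y.
have [_ [[y Py <-] Wy]] := clx _ _ FP' (open_nbhs_nbhs (conj oW Vx)).
by exists y; split=> //; apply: VU.
Qed.

Lemma compact_maximal_ideal_space : compact [set: maximal_ideal_space C].
Proof. exact: compact_set_type compact_characters. Qed.

Lemma Hinf_hat_separating : separating_algebra (Hinf_hat C).
Proof.
have charP (phi : maximal_ideal_space C) :
  complex_homomorphisms C (set_val phi) by exact: set_mem (valP phi).
split.
- move=> _ [f _ <-] phi.
  apply: (@continuous_comp (maximal_ideal_space C) {ptws Hinf C -> C} C
    set_val (fun chi => chi f)).
    exact: initial_continuous.
  exact: continuous_eval.
- move=> c; exists (c *: (1 : Hinf C) : Hinf C) => //.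
  apply/funext => phi; rewrite /gelfand.
  by rewrite (character_cst _ (charP phi)).
- move=> _ _ [f _ <-] [g _ <-]; exists (f + g) => //; apply/funext => phi.
  have [phiL _ _] := charP phi.
  by rewrite /gelfand; have := phiL 1 f g; rewrite scale1r mul1r.
- move=> _ _ [f _ <-] [g _ <-]; exists (f * g) => //; apply/funext => phi.
  by have [_ phiM _] := charP phi; exact: phiM.
- move=> phi psi phipsi; apply: contrapT => nosep; apply: phipsi.
  apply: val_inj; apply/funext => f; apply: contrapT => /eqP neq; apply: nosep.
  by exists (gelfand f); first by exists f.
Qed.

End Spectrum.

(** * The complex plane *)

Section ComplexPlane.
Variable R : realType.
Let C : numFieldType := R[i].

Lemma complex_archi (z : C) : exists n : nat, `|z| < n%:R.
Proof.
have zr : (complex.Re `|z|)%:C = `|z| by rewrite RRe_real// normr_real.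
exists (Num.bound (complex.Re `|z|)); rewrite -zr -(rmorph_nat (real_complex R)).
by rewrite ltcR archi_boundP// -lecR zr rmorph0 normr_ge0.
Qed.

Lemma norm_real_complex (x : R) : `|x%:C : C| = `|x|%:C.
Proof. by rewrite normc_def /= expr0n addr0 sqrtr_sqr. Qed.

Lemma continuous_real_complex : continuous (fun x : R => x%:C : C).
Proof.
move=> x; apply/cvgrPdist_lt => e e0.
have eE : e = (complex.Re e)%:C by rewrite RRe_real// gtr0_real.
have e0' : 0 < complex.Re e by rewrite -ltcR -eE.
near=> y.
rewrite -rmorphB norm_real_complex eE ltcR.
near: y.
move: (complex.Re e) e0'; apply/cvgrPdist_lt; exact: cvg_id.
Unshelve. all: by end_near. Qed.

(** The disc is a closed subset of the image of the square [-m, m] x [-m, m]. *)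
Lemma compact_complex_ball (M : C) : compact [set z : C | `|z| <= M].
Proof.
have [Mr|/negP Mr] := boolP (M \is Num.real); last first.
  have -> : [set z : C | `|z| <= M] = set0.
    apply/seteqP; split=> z //= zM; apply: Mr.
    exact: ger0_real (le_trans (normr_ge0 z) zM).
  exact: compact0.
pose m := complex.Re M; have mE : M = m%:C by rewrite RRe_real.
pose g (p : R * R) : C := p.1%:C + 'i * p.2%:C.
apply: (@subclosed_compact _ _ (g @` (`[-m, m] `*` `[-m, m]))).
- by apply: closed_norm_le => // z; exact: cvg_id.
- apply: continuous_compact; last by apply: compact_setX; exact: segment_compact.
  apply: continuous_subspaceT; apply: continuous_add => [p|].
    by apply: continuous_comp; [exact: cvg_fst|exact: continuous_real_complex].
  apply: continuous_mul => p; first exact: cvg_cst.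
  by apply: continuous_comp; [exact: cvg_snd|exact: continuous_real_complex].
- move=> z /= zM; exists (complex.Re z, complex.Im z); last first.
    by rewrite [RHS]complexE.
  have zr : `|complex.Re z| <= m.
    by rewrite -lecR -mE; exact: le_trans (normc_ge_Re z) zM.
  have zi : `|complex.Im z| <= m.
    rewrite -lecR -mE; apply: le_trans zM; rewrite normc_def lecR -sqrtr_sqr.
    by rewrite ler_wsqrtr// lerDr sqr_ge0.
  by split; rewrite /= in_itv/= -ler_norml.
Qed.

End ComplexPlane.

Theorem theorem4p1 (R : realType) (Q : set (maximal_ideal_space R[i])) :
  Q !=set0 ->
  Q `<=` ~` shilov_boundary (Hinf_hat R[i]) ->
  ~ p_set (Hinf_hat R[i]) Q.
Proof.
move=> Q0 Qshilov pQ.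
have sA := Hinf_hat_separating R[i].
have cK := compact_maximal_ideal_space (@compact_complex_ball R).
have bS : closed_boundary (Hinf_hat R[i]) (shilov_boundary (Hinf_hat R[i])).
  apply: shilov_boundaryP sA cK (@complex_archi R) _.
  by have [q _] := Q0; exists q.
by have [q [qS /Qshilov]] := p_set_meets_boundary sA cK pQ bS Q0.
Qed.
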